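(* Let $R$ be a commutative Noetherian domain of Krull dimension $d$ and $I$ an ideal of $R$. Let $A$ denote either $R[It]$ or $R[It,t^{-1}]$, and let $M$ be a non-zero finitely generated $A$-module. Then $M$ is generated by $e(M):=\sup_{\mathfrak p\in\mathrm{Spec}(A)}\{\mu_{\mathfrak p}(M)+\dim(A/\mathfrak p)\}$ elements.
   Context: For an ideal $I$ of $R$ and an indeterminate $t$, the Rees algebra is $R[It]=\bigoplus_{n\geq 0} I^n t^n\subset R[t]$, and the extended Rees algebra is $R[It,t^{-1}]=\bigoplus_{n\in\mathbb{Z}} I^n t^n\subset R[t,t^{-1}]$, where $I^n=R$ for $n\leq 0$. For a prime $\mathfrak p$ of $A$, $\mu_{\mathfrak p}(M)$ denotes the minimal number of generators of $M_{\mathfrak p}$ over $A_{\mathfrak p}$. *)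

(* Defs.v *)
From HB Require Import structures.
From mathcomp Require Import all_boot all_order all_algebra.
From mathcomp Require Import fraction.
Set Implicit Arguments. Unset Strict Implicit. Unset Printing Implicit Defensive.
Import Order.TTheory GRing.Theory Num.Theory.
Local Open Scope ring_scope.

Section RingNotions.
Variable A : comNzRingType.

Definition is_ideal (P : A -> Prop) : Prop :=
  [/\ P 0, (forall x y, P x -> P y -> P (x + y)) & (forall r x, P x -> P (r * x))].

Definition is_prime (P : A -> Prop) : Prop :=
  [/\ is_ideal P, ~ P 1 & (forall a b, P (a * b) -> P a \/ P b)].

Definition strict_subset (P Q : A -> Prop) : Prop :=
  (forall x, P x -> Q x) /\ exists x, Q x /\ ~ P x.

Definition prime_chain (c : nat -> A -> Prop) (k : nat) : Prop :=
  (forall i, (i <= k)%N -> is_prime (c i)) /\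
  (forall i, (i < k)%N -> strict_subset (c i) (c i.+1)).

Definition krull_dim_eq (d : nat) : Prop :=
  (exists c, prime_chain c d) /\ (forall c k, prime_chain c k -> (k <= d)%N).

Definition dim_quot_ge (p : A -> Prop) (k : nat) : Prop :=
  exists c, prime_chain c k /\ c 0%N = p.

Definition noetherian : Prop :=
  forall J : A -> Prop, is_ideal J ->
    exists n (g : 'I_n -> A), (forall i, J (g i)) /\
      forall x, J x -> exists r : 'I_n -> A, x = \sum_i r i * g i.

Definition ideal_pow (I : A -> Prop) (n : nat) : A -> Prop :=
  fun x => exists (k : nat) (r : 'I_k -> A) (a : 'I_k -> 'I_n -> A),
    (forall j l, I (a j l)) /\ x = \sum_j r j * \prod_l a j l.
End RingNotions.

Section Rees.
Variable R : idomainType.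
Local Notation T := {fraction {poly R}}.
Local Notation tof := (@FracField.tofrac {poly R}).

Definition rees_set (I : R -> Prop) : T -> Prop :=
  fun f => exists p : {poly R}, f = tof p /\ forall i, ideal_pow I i p`_i.

(* R[It,t^-1] = { sum_{n in Z} a_n t^n : a_n in I^n, I^n = R for n <= 0 } ;
   an element is p / t^N with p`_i in I^(i - N) whenever i > N *)
Definition ext_rees_set (I : R -> Prop) : T -> Prop :=
  fun f => exists (N : nat) (p : {poly R}),
    f = tof p / tof ('X ^+ N) /\
    forall i, (N <= i)%N -> ideal_pow I (i - N) p`_i.
End Rees.

Section Modules.
Variables (A : comNzRingType) (M : lmodType A).

Definition generated_by (n : nat) : Prop :=
  exists m : 'I_n -> M, forall x : M, exists a : 'I_n -> A, x = \sum_i a i *: m i.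

Definition fin_gen : Prop := exists n, generated_by n.

(* mu_p(M) <= n : M_p is generated by n elements over A_p
   (unfolded: elements m_i/1 generate M_p, denominators being units) *)
Definition mu_le (p : A -> Prop) (n : nat) : Prop :=
  exists m : 'I_n -> M, forall x : M,
    exists (s : A) (a : 'I_n -> A), ~ p s /\ s *: x = \sum_i a i *: m i.

Definition e_le (n : nat) : Prop :=
  forall p : A -> Prop, is_prime p -> forall k, dim_quot_ge p k ->
    (k <= n)%N /\ mu_le p (n - k).
End Modules.

(* Main.v *)
(* By Hilbert's basis theorem A is Noetherian, as an image of a polynomial ring over R in the
   constants, the elements a t for generators a of I, and t^-1 in the extended case.  As the
   supremum runs over all of Spec(A), the bound is then the Forster-Swan theorem: a prime p
   with mu_p(M) + dim(A/p) = n maximal is minimal in the closed set {q : mu_q(M) >= mu_p(M)},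
   so there are finitely many such p.  Prime avoidance yields m in M with m not in p M_p for
   all of them, and dividing by m lowers the supremum, which gives an induction on n. *)
Require Import Defs.
From HB Require Import structures.
From mathcomp Require Import all_boot all_order all_algebra.
From mathcomp Require Import fraction boolp ring.
From Stdlib Require List.
Set Implicit Arguments. Unset Strict Implicit. Unset Printing Implicit Defensive.
Import GRing.Theory.
Local Open Scope ring_scope.

(** * Ideals and primes of a Noetherian ring *)

Section Ideals.
Variable A : comNzRingType.
Implicit Types (J K P p q : A -> Prop) (s : seq A).

Definition gen_ideal (S : A -> Prop) : A -> Prop :=
  fun x => forall K, is_ideal K -> (forall y, S y -> K y) -> K x.

Lemma gen_idealP (S : A -> Prop) : is_ideal (gen_ideal S).
Proof.
split=> [K [] //|x y hx hy K iK SK|r x hx K iK SK]; case: (iK) => _ KD KM.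
  by apply: KD; [apply: hx | apply: hy].
by apply: KM; apply: hx.
Qed.

Lemma ideal_sum K (I : Type) (r : seq I) (F : I -> A) :
  is_ideal K -> (forall i, K (F i)) -> K (\sum_(i <- r) F i).
Proof. by move=> [K0 KD _] h; apply: (big_ind K). Qed.

Lemma idealB K x y : is_ideal K -> K x -> K y -> K (x - y).
Proof. by move=> [_ KD KM] hx hy; apply: KD => //; rewrite -mulN1r; apply: KM. Qed.

Lemma noetherianP : noetherian A <->
  forall J, is_ideal J -> exists s : seq A,
    (forall x, x \in s -> J x) /\ forall x, J x -> gen_ideal (fun y => y \in s) x.
Proof.
split=> nA J iJ; have [] := nA J iJ.
  move=> n [g [Jg gJ]]; exists (codom g); split=> [_ /codomP[i ->] //|x /gJ[r ->]].
  move=> K iK gK; apply: ideal_sum => // i.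
  by case: iK => _ _; apply; apply/gK/codom_f.
move=> s [Js sJ]; exists (size s), (fun i => s`_i); split=> [i|x /sJ gx]; first exact/Js/mem_nth.
apply: (gx (fun y => exists r : 'I_(size s) -> A, y = \sum_i r i * s`_i)) => [|y ys]; first split.
- by exists (fun=> 0); rewrite big1 // => i _; rewrite mul0r.
- move=> _ _ [a ->] [b ->]; exists (fun i => a i + b i).
  by rewrite -big_split; apply: eq_bigr => i _; rewrite mulrDl.
- move=> r _ [a ->]; exists (fun i => r * a i).
  by rewrite mulr_sumr; apply: eq_bigr => i _; rewrite mulrA.
have ltys : (index y s < size s)%N by rewrite index_mem.
exists (fun i => (i == Ordinal ltys)%:R).
rewrite (bigD1 (Ordinal ltys)) //= eqxx mul1r nth_index // big1 ?addr0 // => i /negPf ->.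
by rewrite mul0r.
Qed.

(** Otherwise choice builds a strictly ascending chain of counterexamples. Its union is generated by
    finitely many elements, all lying in one term, so the chain could not grow past it. *)
Lemma noetherian_ind (P : (A -> Prop) -> Prop) :
  noetherian A ->
  (forall J, is_ideal J ->
    (forall K, is_ideal K -> strict_subset J K -> P K) -> P J) ->
  forall J, is_ideal J -> P J.
Proof.
move=> /noetherianP nA step J iJ; apply: contrapT => nPJ.
pose T := {K | is_ideal K /\ ~ P K}.
have /choice[f fP] (K : T) : exists L : T, strict_subset (sval K) (sval L).
  case: K => K [iK nPK] /=; apply: contrapT => nL; apply: nPK.
  apply: step => // L iL KL; apply: contrapT => nPL; apply: nL.
  by exists (exist _ L (conj iL nPL)).
pose c n := iter n f (exist _ J (conj iJ nPJ)).
have cW m n x : (m <= n)%N -> sval (c m) x -> sval (c n) x.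
  move=> /subnK <- hx; elim: (n - m)%N => // k; exact: (fP (c (k + m)%N)).1.
have ci n : is_ideal (sval (c n)) by case: (c n) => K [].
pose U x := exists n, sval (c n) x.
have iU : is_ideal U.
  split=> [|x y [m hx] [n hy]|r x [n hx]]; first by exists 0%N; case: (ci 0%N).
    exists (m + n)%N; case: (ci (m + n)%N) => _ + _; apply.
      by apply: cW hx; rewrite leq_addr.
    by apply: cW hy; rewrite leq_addl.
  by exists n; case: (ci n) => _ _; apply.
have [s [Us sU]] := nA U iU.
have [n hn] : exists n, forall x, x \in s -> sval (c n) x.
  elim: s Us {sU} => [|y s IHs] Us; first by exists 0%N.
  have [m hm] := IHs (fun x xs => Us x (mem_behead (s := y :: s) xs)).
  have [k hk] := Us y (mem_head _ _).
  exists (m + k)%N => x; rewrite inE => /orP[/eqP->|/hm h].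
    by apply: cW hk; rewrite leq_addl.
  by apply: cW h; rewrite leq_addr.
have [_ [x [hx]]] := fP (c n); apply.
by apply: sU (ci n) hn; exists n.+1.
Qed.

(** The ideal [J + (a)]. *)
Definition add_principal J (a : A) : A -> Prop := fun x => exists r, J (x - r * a).

Lemma add_principal_ideal J a : is_ideal J -> is_ideal (add_principal J a).
Proof.
move=> [J0 JD JM]; split=> [|x y [b hb] [c hc]|r x [b hb]].
- by exists 0; rewrite mul0r subr0.
- by exists (b + c); rewrite (_ : _ - _ = x - b * a + (y - c * a)); [apply: JD|ring].
- by exists (r * b); rewrite -mulrA -mulrBr; apply: JM.
Qed.

Lemma add_principal_strict J a :
  is_ideal J -> ~ J a -> strict_subset J (add_principal J a).
Proof.
move=> [J0 JD JM] nJa; split=> [x hx|]; first by exists 0; rewrite mul0r subr0.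
by exists a; split=> //; exists 1; rewrite mul1r subrr.
Qed.

Lemma not_prime_witness J : is_ideal J -> ~ J 1 -> ~ is_prime J ->
  exists a b, [/\ J (a * b), ~ J a & ~ J b].
Proof.
move=> iJ J1 npJ; apply: contrapT => nab; apply: npJ; split=> // a b Jab.
apply: contrapT => /not_orP[nJa nJb]; apply: nab; by exists a, b.
Qed.

(** A prime [J] would contradict the hypothesis at [J] itself. If [a * b] lies in [J] and neither
    factor does, induction puts 1 in [J + (a)] and in [J + (b)]; multiplying the two expressions
    puts it in [J]. *)
Lemma unit_ideal_of_no_prime J : noetherian A -> is_ideal J ->
  (forall p, is_prime p -> exists x, J x /\ ~ p x) -> J 1.
Proof.
move=> nA; move: J; apply: noetherian_ind => // J iJ IH Jp.
apply: contrapT => nJ1.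
case: (EM (is_prime J)) => [/Jp[x []] //|/(not_prime_witness iJ nJ1)[a [b [Jab nJa nJb]]]].
have unit_add c : ~ J c -> add_principal J c 1.
  move=> nJc; apply: IH; [exact: add_principal_ideal|exact: add_principal_strict|].
  move=> p /Jp[x [Jx npx]]; exists x; split=> //.
  exact: (add_principal_strict iJ nJc).1.
have [[u ua] [v vb]] := (unit_add a nJa, unit_add b nJb).
case: iJ => _ JD JM; apply: nJ1.
rewrite (_ : 1 = (1 - u * a) + u * a * (1 - v * b) + u * v * (a * b)); last by ring.
by apply: (JD); [apply: (JD) => //|]; apply: (JM).
Qed.

(** A prime over [J] containing [a * b] contains [a] or [b], so the lists for [J + (a)] and
    [J + (b)] together serve for [J]. The result includes all minimal primes of [J], possibly with
    others. *)
Lemma finite_primes_over_ideal J : noetherian A -> is_ideal J ->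
  exists Q : seq (A -> Prop),
    (forall q, List.In q Q -> is_prime q /\ forall x, J x -> q x) /\
    forall p, is_prime p -> (forall x, J x -> p x) ->
      exists q, List.In q Q /\ forall x, q x -> p x.
Proof.
move=> nA; move: J; apply: noetherian_ind => // J iJ IH.
case: (EM (J 1)) => [J1|nJ1].
  by exists [::]; split=> // p [_ np1 _] /(_ 1 J1).
case: (EM (is_prime J)) => [pJ|/(not_prime_witness iJ nJ1)[a [b [Jab nJa nJb]]]].
  by exists [:: J]; split=> [q [<-|//]|p pp Jp] //; exists J; split=> //; left.
have [Qa [Qa1 Qa2]] := IH _ (add_principal_ideal a iJ) (add_principal_strict iJ nJa).
have [Qb [Qb1 Qb2]] := IH _ (add_principal_ideal b iJ) (add_principal_strict iJ nJb).
exists (Qa ++ Qb); split=> [q /List.in_app_iff[]|p pp Jp].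
- by move=> /Qa1[pq hq]; split=> // x Jx; apply/hq/(add_principal_strict iJ nJa).1.
- by move=> /Qb1[pq hq]; split=> // x Jx; apply/hq/(add_principal_strict iJ nJb).1.
case: (pp) => [[p0 pD pM] _ pP].
have cover c : p c -> forall x, add_principal J c x -> p x.
  move=> pc x [r hr]; rewrite -[x](subrK (r * c)); apply: pD; first exact: Jp.
  exact: pM.
case: (pP _ _ (Jp _ Jab)) => /cover /= h.
  by have [q [hq ?]] := Qa2 p pp h; exists q; split=> //; apply/List.in_app_iff; left.
by have [q [hq ?]] := Qb2 p pp h; exists q; split=> //; apply/List.in_app_iff; right.
Qed.

Lemma finite_primes_over (S : A -> Prop) : noetherian A ->
  exists Q : seq (A -> Prop),
    (forall q, List.In q Q -> is_prime q /\ forall x, S x -> q x) /\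
    forall p, is_prime p -> (forall x, S x -> p x) ->
      exists q, List.In q Q /\ forall x, q x -> p x.
Proof.
move=> nA; have [Q [Q1 Q2]] := finite_primes_over_ideal nA (gen_idealP S).
exists Q; split=> [q /Q1[pq hq]|p pp Sp].
  by split=> // x Sx; apply: hq => K _; apply.
by apply: Q2 => // x; apply=> //; case: pp.
Qed.

Lemma prime_antisym p q : (forall x, p x -> q x) -> (forall x, q x -> p x) -> p = q.
Proof. by move=> pq qp; apply/funext => x; apply/propext; split; [apply: pq|apply: qp]. Qed.

Lemma dim_quot_ge_cons p q k : is_prime q -> strict_subset q p ->
  dim_quot_ge p k -> dim_quot_ge q k.+1.
Proof.
move=> pq qp [c [[c1 c2] c0]].
by exists (fun i => if i is i'.+1 then c i' else q); split=> //;
  split=> [[|i]|[|i]] //=; rewrite ?ltnS ?c0; auto.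
Qed.

Lemma dim_quot_ge0 p : is_prime p -> dim_quot_ge p 0.
Proof. by move=> pp; exists (fun=> p). Qed.

Lemma primeM p x y : is_prime p -> ~ p x -> ~ p y -> ~ p (x * y).
Proof. by move=> [_ _ pP] px py /pP[]. Qed.

Lemma minimal_prime_in (Q : seq (A -> Prop)) : Q <> [::] ->
  exists q, List.In q Q /\
    forall p, List.In p Q -> (forall x, p x -> q x) -> p = q.
Proof.
elim: Q => // q [|q' Q] IH _.
  by exists q; split=> [|p [|//]]; [left|].
have [//|q0 [q0Q q0min]] := IH.
case: (EM (forall x, q x -> q0 x)) => [qq0|nqq0].
  exists q; split=> [|p [//|pQ] pq]; first by left.
  have e := q0min p pQ (fun x px => qq0 x (pq x px)).
  by apply: prime_antisym => // x /qq0; rewrite e.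
exists q0; split; first by right.
by move=> p [<- //|pQ]; apply: q0min.
Qed.

(** The element for prime avoidance: one witness from each [p] is multiplied in, and primality keeps
    the product outside [q]. *)
Lemma prime_product (Q : seq (A -> Prop)) q : is_prime q ->
  (forall p, List.In p Q -> is_ideal p) ->
  (forall p, List.In p Q -> exists x, p x /\ ~ q x) ->
  exists r, ~ q r /\ forall p, List.In p Q -> p r.
Proof.
move=> pq; elim: Q => [|p Q IH] iQ hQ.
  by exists 1; split=> //; case: pq.
have [r [qr rQ]] := IH (fun p h => iQ p (or_intror h)) (fun p h => hQ p (or_intror h)).
have [x [px qx]] := hQ p (or_introl erefl).
exists (r * x); split=> [|p' [<-|p'Q]]; first exact: primeM.
  by case: (iQ p (or_introl erefl)) => _ _; apply.
by rewrite mulrC; case: (iQ p' (or_intror p'Q)) => _ _; apply; apply: rQ.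
Qed.

End Ideals.

(** * Hilbert's basis theorem *)

Lemma hilbert_basis (S : comNzRingType) : noetherian S -> noetherian {poly S}.
Proof.
move=> /noetherianP nS; apply/noetherianP => J iJ; case: (iJ) => J0 JD JM.
(* With [K] the whole ring this is the ideal of degree [n] leading coefficients of [J]. For an ideal
   [K] containing the chosen generators, it measures how much of that ideal [K] recovers. *)
pose L (K : {poly S} -> Prop) n (c : S) :=
  exists q, [/\ J q, K q, (size q <= n.+1)%N & q`_n = c].
have iL K n : is_ideal K -> is_ideal (L K n).
  move=> [K0 KD KM]; split=> [|_ _ [q [Jq Kq sq <-]] [r [Jr Kr sr <-]]|a _ [q [Jq Kq sq <-]]].
  - by exists 0; split; rewrite ?size_poly0 ?coef0.
  - exists (q + r); split; [exact: JD|exact: KD| |by rewrite coefD].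
    by apply: leq_trans (size_polyD _ _) _; rewrite geq_max sq.
  - exists (a%:P * q); split; [exact: JM|exact: KM| |by rewrite coefCM].
    by rewrite mul_polyC; apply: leq_trans (size_scale_leq _ _) sq.
have LX K m n c : is_ideal K -> L K m c -> (m <= n)%N -> L K n c.
  move=> [K0 KD KM] [q [Jq Kq sq <-]] mn; exists ('X^(n - m) * q).
  split; [exact: JM|exact: KM| |by rewrite coefXnM ltnNge leq_subr subKn].
  apply: leq_trans (size_polyMleq _ _) _; rewrite size_polyXn /=.
  by rewrite -(subnK mn) -addnS !addnK leq_add2l.
have iT : is_ideal (fun _ : {poly S} => True) by [].
pose Li c := exists n, L (fun=> True) n c.
have iLi : is_ideal Li.
  split=> [|x y [m hx] [n hy]|r x [n hx]]; first by exists 0%N; case: (iL _ 0%N iT).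
    exists (m + n)%N; case: (iL _ (m + n)%N iT) => _ + _; apply.
      by apply: LX hx _ => //; rewrite leq_addr.
    by apply: LX hy _ => //; rewrite leq_addl.
  by exists n; case: (iL _ n iT) => _ _; apply.
have [s [Ls sL]] := nS Li iLi.
(* Multiplying by powers of ['X] brings the generators of [Li] to a common degree [D], beyond which
   no new leading coefficient appears. *)
have [D hD] : exists D, forall c, c \in s -> L (fun=> True) D c.
  elim: s Ls {sL} => [|y s IHs] Ls; first by exists 0%N.
  have [m hm] := IHs (fun x xs => Ls x (mem_behead (s := y :: s) xs)).
  have [k hk] := Ls y (mem_head _ _).
  exists (m + k)%N => x; rewrite inE => /orP[/eqP->|/hm h].
    by apply: LX hk _; rewrite ?leq_addl.
  by apply: LX h _; rewrite ? leq_addr.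
have LD n c : L (fun=> True) n c -> L (fun=> True) D c.
  by move=> hc; apply: sL (iL _ D iT) hD; exists n.
(* Enough elements of J to recover the n-th ideal of leading coefficients. *)
have fin n : exists t : seq {poly S}, (forall q, q \in t -> J q) /\
    forall K, is_ideal K -> (forall q, q \in t -> K q) ->
      forall c, L (fun=> True) n c -> L K n c.
  have [u [uL Lu]] := nS _ (iL _ n iT).
  have [t [Jt tL]] : exists t : seq {poly S}, (forall q, q \in t -> J q) /\
      forall K, (forall q, q \in t -> K q) -> forall c, c \in u -> L K n c.
    elim: u uL {Lu} => [|y u IHu] uL; first by exists [::].
    have [t [Jt tL]] := IHu (fun x xs => uL x (mem_behead (s := y :: u) xs)).
    have [q [Jq _ sq qn]] := uL y (mem_head _ _).
    exists (q :: t); split=> [r|K tK c]; rewrite inE.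
      by move=> /orP[/eqP->|/Jt].
    move=> /orP[/eqP->|]; first by exists q; split=> //; apply: tK; rewrite mem_head.
    by apply: tL => r rt; apply: tK; rewrite inE rt orbT.
  by exists t; split=> // K iK tK c /Lu; apply; [apply: iL|apply: tL].
have [t [Jt tL]] : exists t : seq {poly S}, (forall q, q \in t -> J q) /\
    forall K, is_ideal K -> (forall q, q \in t -> K q) ->
      forall n, (n <= D)%N -> forall c, L (fun=> True) n c -> L K n c.
  elim: D {hD LD} => [|D [t [Jt tL]]].
    by have [t [Jt tL]] := fin 0%N; exists t; split=> // K iK tK [] // _; apply: tL.
  have [u [Ju uL]] := fin D.+1; exists (t ++ u); split=> [q|K iK tK n].
    by rewrite mem_cat => /orP[/Jt|/Ju].
  rewrite leq_eqVlt => /orP[/eqP->|]; first by apply: uL => // q qu; apply: tK; rewrite mem_cat qu orbT.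
  by rewrite ltnS; apply: tL => // q qt; apply: tK; rewrite mem_cat qt.
exists t; split=> // x Jx K iK tK; case: (iK) => K0 KD KM.
(* Induction on the size: the leading term of [p] is cancelled by an element of both [J] and [K]. *)
have [n] := ubnP (size x); elim: n x Jx => // n IHn p Jp; rewrite ltnS => sp.
have [->//|p0] := eqVneq p 0.
have Lp : L (fun=> True) (size p).-1 (lead_coef p).
  by exists p; split=> //; rewrite prednK // size_poly_gt0.
(* The degree is capped at [D], where generators were chosen; a power of ['X] then lifts back to the
   degree of [p]. *)
have LKp : L K (minn (size p).-1 D) (lead_coef p).
  apply: tL => //; first exact: geq_minr.
  by have [_|_] := leqP (size p).-1 D; [|apply: LD Lp].
have [q [Jq Kq sq qn]] := LX _ _ _ _ iK LKp (geq_minl _ _).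
rewrite -[p](subrK q); apply: KD => //; apply: IHn; first exact: idealB.
have sz : (size p).-1.+1 = size p by rewrite prednK // size_poly_gt0.
apply: leq_trans sp; rewrite -sz ltnS; apply/leq_sizeP => j.
rewrite leq_eqVlt => /orP[/eqP<-|ltj]; first by rewrite coefB qn lead_coefE subrr.
by rewrite coefB !nth_default ?subrr //; [apply: leq_trans sq _|rewrite -sz].
Qed.

(** * Submodules, local generation and basic elements *)

Section Modules.
Variables (A : comNzRingType) (M : lmodType A).
Implicit Types (N K : M -> Prop) (Q p q : A -> Prop) (ms : seq M) (m x y : M).

Definition is_submod N : Prop :=
  [/\ N 0, (forall x y, N x -> N y -> N (x + y)) & (forall a x, N x -> N (a *: x))].

Definition all_coefs : A -> Prop := fun=> True.

(** Restricting coefficients to an ideal [Q] gives both [N + A m] and [N + p m]; the latter serves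
    Nakayama's lemma. *)
Definition add_multiples Q m N : M -> Prop := fun x => exists2 a, Q a & N (x - a *: m).

(* N + Q m_1 + ... + Q m_r *)
Definition span Q N ms : M -> Prop := foldr (add_multiples Q) N ms.

(* (M/N)_p is generated by j elements; quotients of M are represented by the
   submodules N one divides by, so that no quotient type is needed. *)
Definition mu_mod N p (j : nat) : Prop :=
  exists2 ms, (size ms <= j)%N & forall x, exists2 s, ~ p s & span all_coefs N ms (s *: x).

(* x / 1 lies in p (M/N)_p; the elements x outside this submodule are the basic ones *)
Definition nonbasic N p : M -> Prop := fun x => exists2 s, ~ p s &
  forall K, is_submod K -> (forall y, N y -> K y) -> (forall a y, p a -> K (a *: y)) ->
    K (s *: x).

Lemma submodB N x y : is_submod N -> N x -> N y -> N (x - y).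
Proof. by move=> [_ ND NZ] hx hy; apply: ND => //; rewrite -scaleN1r; apply: NZ. Qed.

Lemma all_coefs_ideal : is_ideal all_coefs. Proof. by []. Qed.

Lemma span_submod Q N ms : is_ideal Q -> is_submod N -> is_submod (span Q N ms).
Proof.
move=> [Q0 QD QM] iN; elim: ms => //= m ms [S0 SD SZ].
split=> [|x y [a qa ha] [b qb hb]|r x [a qa ha]].
- by exists 0; rewrite // scale0r subr0.
- by exists (a + b); [apply: QD|rewrite scalerDl opprD addrACA; apply: SD].
- by exists (r * a); [apply: QM|rewrite -scalerA -scalerBr; apply: SZ].
Qed.

Lemma sub_span Q N ms x : is_ideal Q -> N x -> span Q N ms x.
Proof.
by move=> [Q0 _ _] Nx; elim: ms => //= m ms IH; exists 0; rewrite ?scale0r ?subr0.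
Qed.

Lemma mem_span Q N ms a m : is_ideal Q -> is_submod N ->
  m \in ms -> Q a -> span Q N ms (a *: m).
Proof.
move=> iQ iN + qa; elim: ms => //= m' ms IH; rewrite inE => /orP[/eqP<-|/IH h].
  by exists a; rewrite // subrr; case: (span_submod ms iQ iN).
by exists 0; rewrite ?scale0r ?subr0 //; case: iQ.
Qed.

Lemma span_min Q N ms K x : is_submod K -> (forall y, N y -> K y) ->
  (forall a m, m \in ms -> Q a -> K (a *: m)) -> span Q N ms x -> K x.
Proof.
move=> iK NK; elim: ms x => [|m ms IH] x msK /=; first exact: NK.
move=> [a qa /IH h]; rewrite -[x](subrK (a *: m)); case: (iK) => _ KD _; apply: KD.
  by apply: h => b m' mm'; apply: msK; rewrite inE mm' orbT.
by apply: msK; rewrite ?mem_head.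
Qed.

Lemma span_all_min N ms K x : is_submod K -> (forall y, N y -> K y) ->
  (forall m, m \in ms -> K m) -> span all_coefs N ms x -> K x.
Proof.
by move=> iK NK msK; apply: span_min => // a m /msK h _; case: iK => _ _; apply.
Qed.

Lemma mem_span_all N ms m : is_submod N -> m \in ms -> span all_coefs N ms m.
Proof. by move=> iN mm; rewrite -[m]scale1r; apply: mem_span. Qed.

Lemma add_multiples_submod Q m N : is_ideal Q -> is_submod N -> is_submod (add_multiples Q m N).
Proof. exact: (@span_submod Q N [:: m]). Qed.

Lemma span_ideal_coef p N ms a x : is_ideal p -> is_submod N -> p a ->
  span all_coefs N ms x -> span p N ms (a *: x).
Proof.
move=> ip iN pa; have iS := span_submod ms ip iN.
apply: (@span_all_min N ms (fun y => span p N ms (a *: y))).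
- case: iS => S0 SD SZ; split=> [|y z|r y hy]; first by rewrite scaler0.
    by rewrite scalerDr; apply: SD.
  by rewrite scalerA mulrC -scalerA; apply: SZ.
- by move=> y Ny; apply: sub_span => //; case: iN => _ _; apply.
- by move=> m mm; apply: mem_span.
Qed.

Lemma nonbasic_submod N p : is_prime p -> is_submod (nonbasic N p).
Proof.
move=> pp; case: (pp) => _ p1 _; split=> [|x y [s ps hs] [t pt ht]|r x [s ps hs]].
- by exists 1 => // K [K0 _ _]; rewrite scaler0.
- exists (s * t); first exact: primeM.
  move=> K iK NK pK; case: (iK) => _ KD KZ; rewrite scalerDr; apply: KD.
    by rewrite mulrC -scalerA; apply: KZ; apply: hs.
  by rewrite -scalerA; apply: KZ; apply: ht.
- exists s => // K iK NK pK; rewrite scalerA mulrC -scalerA.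
  by case: (iK) => _ _; apply; apply: hs.
Qed.

Lemma nonbasicZ N p a x : is_prime p -> p a -> nonbasic N p (a *: x).
Proof.
move=> pp pa; exists 1 => [|K iK NK pK]; first by case: pp.
by rewrite scale1r; apply: pK.
Qed.

Lemma nonbasic_div N p a x : is_prime p -> ~ p a -> nonbasic N p (a *: x) -> nonbasic N p x.
Proof.
move=> pp pa [s ps hs]; exists (s * a); first exact: primeM.
by move=> K iK NK pK; rewrite -scalerA; apply: hs.
Qed.

(** The elements having a multiple, by some scalar outside [p], in [span p N ms] form a submodule.
    It contains [N] and, since [ms] generates locally, all of [p M]. *)
Lemma nonbasic_coefs N p ms x : is_prime p -> is_submod N ->
  (forall y, exists2 s, ~ p s & span all_coefs N ms (s *: y)) ->
  nonbasic N p x -> exists2 s, ~ p s & span p N ms (s *: x).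
Proof.
move=> pp iN gen [s ps hs]; case: (pp) => ip p1 _.
have [_ SD SZ] := span_submod ms ip iN.
have [t pt ht] : exists2 t, ~ p t & span p N ms (t *: (s *: x)).
  apply: (hs (fun y => exists2 t, ~ p t & span p N ms (t *: y))).
  - split=> [|y z [t pt ht] [u pu hu]|r y [t pt ht]].
    + by exists 1; rewrite // scaler0; case: (span_submod ms ip iN).
    + exists (t * u); first exact: primeM.
      rewrite scalerDr; apply: SD; last by rewrite -scalerA; apply: SZ.
      by rewrite mulrC -scalerA; apply: SZ.
    + by exists t => //; rewrite scalerA mulrC -scalerA; apply: SZ.
  - by move=> y Ny; exists 1; rewrite // scale1r; apply: sub_span.
  - move=> a y pa; have [t pt ht] := gen y; exists t => //.
    by rewrite scalerA mulrC -scalerA; apply: span_ideal_coef.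
by exists (t * s); [apply: primeM|rewrite -scalerA].
Qed.

(* Nakayama's lemma: a nonbasic member of a local generating family is redundant. *)
Lemma exists_basic N p j : is_prime p -> is_submod N ->
  mu_mod N p j.+1 -> ~ mu_mod N p j -> exists x, ~ nonbasic N p x.
Proof.
move=> pp iN [ms sms gen] nmu; case: (pp) => ip _ _; apply: contrapT => nb.
have {nb} nb x : nonbasic N p x by apply: contrapT => nbx; apply: nb; exists x.
case: ms sms gen => [|m ms] sms gen; first by apply: nmu; exists [::].
apply: nmu; exists ms => // x; have [s ps [a pa]] := nonbasic_coefs pp iN gen (nb m).
rewrite -scalerBl => hm; have [t pt [b _ hx]] := gen x.
have psa : ~ p (s - a).
  by move=> psa; apply: ps; rewrite -[s](subrK a); case: ip => _ pD _; apply: pD.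
have [_ SD SZ] := span_submod ms all_coefs_ideal iN.
have {}hm : span all_coefs N ms ((s - a) *: m).
  apply: span_min hm => [|y Ny|c y yms _]; first exact: span_submod.
    exact: sub_span.
  exact: mem_span.
exists ((s - a) * t); first exact: primeM.
rewrite -scalerA -[t *: x](subrK (b *: m)) scalerDr; apply: SD; first exact: SZ.
by rewrite scalerA mulrC -scalerA; apply: SZ.
Qed.

(** A coefficient of [y] outside [p] is locally invertible, so the generator carrying it can be
    replaced by [y]. The induction passes over leading generators whose coefficients lie in [p]. *)
Lemma exchange N p ms y : is_prime p -> is_submod N -> span all_coefs N ms y ->
  span p N ms y \/ exists2 ms', (size ms' < size ms)%N & exists2 s, ~ p s &
    forall x, span all_coefs N ms x ->
      span all_coefs (add_multiples all_coefs y N) ms' (s *: x).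
Proof.
move=> pp iN; case: (pp) => ip _ _.
have iNy z := add_multiples_submod z all_coefs_ideal iN.
have iS z ms' := span_submod ms' all_coefs_ideal (iNy z).
have Nsub z w : N w -> add_multiples all_coefs z N w.
  by move=> Nw; exists 0; rewrite // scale0r subr0.
have Nself z : add_multiples all_coefs z N z.
  by exists 1; rewrite // scale1r subrr; case: iN.
elim: ms y => [|m ms IH] y /=; first by left.
move=> [a _ hy]; case: (EM (p a)) => [pa|pa].
  case: (IH _ hy) => [hp|[ms' sms' [s ps hs]]]; first by left; exists a.
  (* The head [m] is kept: the element exchanged in the tail is [y - a *: m], a combination of [y]
     and [m]. *)
  right; exists (m :: ms') => //; exists s => // x [b _ /hs hx].
  have [_ SD SZ] := iS y (m :: ms').
  rewrite -[x](subrK (b *: m)) scalerDr; apply: (SD).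
    apply: span_all_min hx => //.
      move=> z [c _ hz]; rewrite -[z](subrK (c *: (y - a *: m))); apply: SD.
        by apply: sub_span => //; apply: Nsub.
      apply: (SZ); apply: submodB => //; first by apply: sub_span.
      by apply: mem_span => //; rewrite mem_head.
    by move=> z zms'; apply: mem_span_all; rewrite // inE zms' orbT.
  by rewrite scalerA; apply: mem_span => //; rewrite mem_head.
right; exists ms => //; exists a => // x [b _ hx].
have [_ SD SZ] := iS y ms.
have mono z : span all_coefs N ms z -> span all_coefs (add_multiples all_coefs y N) ms z.
  apply: span_all_min => // [w Nw|w wms]; first by apply: sub_span => //; apply: Nsub.
  exact: mem_span_all.
have -> : a *: x = a *: (x - b *: m) + b *: (y - (y - a *: m)).
  by rewrite subKr scalerBr !scalerA [b * a]mulrC subrK.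
apply: SD; first exact/SZ/mono.
by apply: SZ; apply: submodB => //; [exact: sub_span|exact: mono].
Qed.

(** The coefficients of a basic element cannot all lie in [p], so [m] replaces one local generator,
    and modulo [m] one fewer is needed. *)
Lemma mu_mod_basic N p m j : is_prime p -> is_submod N -> ~ nonbasic N p m ->
  mu_mod N p j.+1 -> mu_mod (add_multiples all_coefs m N) p j.
Proof.
move=> pp iN nbm [ms sms gen]; case: (pp) => ip p1 _.
(* Only a multiple of [m] by some [s] outside [p] need lie in the span, so the exchange is made with
   [s *: m]. *)
have [s ps hs] := gen m; case: (exchange pp iN hs) => [hp|[ms' sms' [t pt ht]]].
  case: nbm; exists s => // K iK NK pK.
  by apply: span_min hp => // a y _; apply: pK.
exists ms' => [|x]; first by rewrite -ltnS (leq_trans sms').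
have [u pu /ht hu] := gen x; exists (t * u); first exact: primeM.
have iNm := add_multiples_submod m all_coefs_ideal iN.
have [_ _ SZ] := span_submod ms' all_coefs_ideal iNm.
rewrite -scalerA; apply: span_all_min hu; first exact: span_submod.
  move=> z [c _ hz]; apply: sub_span => //; exists (c * s) => //.
  by rewrite -scalerA.
by move=> z zms; apply: mem_span_all.
Qed.

Lemma mu_mod_mono N K p i j : is_submod K -> (forall x, N x -> K x) -> (i <= j)%N ->
  mu_mod N p i -> mu_mod K p j.
Proof.
move=> iK NK ij [ms sms gen]; exists ms => [|x]; first exact: leq_trans ij.
have [s ps hs] := gen x; exists s => //.
apply: span_all_min hs => [|y /NK Ky|m mms]; first exact: span_submod.
  exact: sub_span.
exact: mem_span_all.
Qed.

(** A minimal prime [q] is set aside. An element basic at the others is corrected at [q] by adding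
    [r *: y], with [y] basic at [q] and [r] in every other prime but not in [q]. *)
Lemma common_basic N (L : seq (A -> Prop)) : is_submod N ->
  (forall q, List.In q L -> is_prime q /\ exists x, ~ nonbasic N q x) ->
  exists x, forall q, List.In q L -> ~ nonbasic N q x.
Proof.
move=> iN; have [n] := ubnP (size L); elim: n L => // n IH L; rewrite ltnS => sL hL.
case: (EM (L = [::])) => [->|L0]; first by exists 0.
have [q [qL qmin]] := minimal_prime_in L0.
have [L1 [L2 eL]] := List.in_split q L qL.
have sub r : List.In r (L1 ++ L2) -> List.In r L.
  rewrite eL => /List.in_app_iff h; apply/List.in_app_iff.
  by case: h => h; [left|right; right].
have sL' : (size (L1 ++ L2) < n)%N by move: sL; rewrite eL !size_cat /= addnS.
have [x hx] := IH _ sL' (fun r h => hL r (sub r h)).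
have inL r : List.In r L -> r = q \/ List.In r (L1 ++ L2).
  rewrite eL => /List.in_app_iff[h|[<-|h]]; [right|by left|right];
    by apply/List.in_app_iff; auto.
(* The list may repeat [q]; the induction hypothesis then covers it. *)
case: (EM (List.In q (L1 ++ L2))) => [qL'|qL'].
  by exists x => r /inL[->|]; apply: hx.
case: (EM (nonbasic N q x)) => [nbx|bx]; last by exists x => r /inL[->|]; last exact: hx.
have [pq [y by_]] := hL q qL.
(* By minimality of [q], no other prime of the list is contained in it. *)
have [r [qr hr]] : exists r, ~ q r /\ forall p, List.In p (L1 ++ L2) -> p r.
  apply: prime_product => // [p /sub/hL[[]] //|p pL].
  apply: contrapT => npq; apply: qL'; rewrite -(qmin p (sub p pL)) // => z pz.
  by apply: contrapT => qz; apply: npq; exists z.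
exists (x + r *: y) => p /inL[->|pL] nb.
  apply: by_; apply: nonbasic_div qr _ => //.
  by rewrite -[r *: y](addKr x) addrC; apply: submodB (nonbasic_submod N pq) _ _.
have [pp _] := hL p (sub p pL); apply: (hx p pL); rewrite -[x](addrK (r *: y)).
by apply: submodB (nonbasic_submod N pp) nb _; apply: nonbasicZ => //; apply: hr.
Qed.

(* A prime p lies outside the closed set defined by the elements below iff mu_mod N p j. *)
Definition mu_locus N (j : nat) : A -> Prop := fun s =>
  exists2 ms, (size ms <= j)%N & forall x : M, span all_coefs N ms (s *: x).

(** Each of the finitely many global generators in [G] needs one denominator, and the product of
    these serves for all of [M]. *)
Lemma mu_mod_locus N p (G : seq M) j : is_prime p -> is_submod N ->
  (forall x, span all_coefs (fun y => y = 0) G x) ->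
  mu_mod N p j -> exists2 s, ~ p s & mu_locus N j s.
Proof.
move=> pp iN genG [ms sms gen]; case: (pp) => _ p1 _.
have iS := span_submod ms all_coefs_ideal iN; have [S0 SD SZ] := iS.
have [s ps hs] : exists2 s, ~ p s & forall g, g \in G -> span all_coefs N ms (s *: g).
  elim: (G) => [|g G' [s ps hs]]; first by exists 1.
  have [t pt ht] := gen g; exists (s * t); first exact: primeM.
  move=> h; rewrite inE => /orP[/eqP->|/hs]; first by rewrite -scalerA; apply: SZ.
  by rewrite mulrC -scalerA; apply: SZ.
exists s => //; exists ms => // x.
apply: (span_all_min (K := fun y => span all_coefs N ms (s *: y)) _ _ hs (genG x)).
  split=> [|y z|a y]; rewrite ?scaler0 ?scalerDr //; first exact: SD.
  by rewrite scalerA mulrC -scalerA; apply: SZ.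
by move=> y ->; rewrite scaler0.
Qed.

Lemma mu_locus_mod N p j s : ~ p s -> mu_locus N j s -> mu_mod N p j.
Proof. by move=> ps [ms sms h]; exists ms => // x; exists s. Qed.

(** The scalars carrying [x] into [N] form an ideal contained in no prime, hence the unit ideal. *)
Lemma submod_total_of_local N : noetherian A -> is_submod N ->
  (forall p, is_prime p -> mu_mod N p 0) -> forall x, N x.
Proof.
move=> nA [N0 ND NZ] loc x; rewrite -[x]scale1r.
apply: (unit_ideal_of_no_prime (J := fun s => N (s *: x))) => // [|p pp].
  split=> [|a b|a b]; first by rewrite scale0r.
    by rewrite scalerDl; apply: ND.
  by rewrite -scalerA; apply: NZ.
have [[|//] _ /(_ x)[s ps hs]] := loc p pp.
by exists s.
Qed.

(** * The Forster-Swan theorem *)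

(** Each step replaces [N] by [N + A m]. Subtraction is truncated: for [k > n] the hypothesis says
    that [M/N] vanishes at [p]. Primes off the support thus meet it whatever their dimension, which
    lets it survive the passage from [n.+1] to [n]. *)
Lemma forster_swan_mod (G : seq M) N n : noetherian A ->
  (forall x, span all_coefs (fun y => y = 0) G x) -> is_submod N ->
  (forall p, is_prime p -> forall k, dim_quot_ge p k -> mu_mod N p (n - k)) ->
  exists2 ms, (size ms <= n)%N & forall x, span all_coefs N ms x.
Proof.
move=> nA genG; elim: n N => [|n IHn] N iN loc.
  exists [::] => //=; apply: submod_total_of_local => // p pp.
  exact: (loc p pp 0%N (dim_quot_ge0 pp)).
(* For each [j <= n], [L] includes the minimal primes of the closed set where more than [j]
   generators are needed. *)
have [L [L1 L2]] : exists L : seq (A -> Prop),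
    (forall q, List.In q L -> is_prime q /\ exists x, ~ nonbasic N q x) /\
    forall j, (j <= n)%N -> forall p, is_prime p -> (forall s, mu_locus N j s -> p s) ->
      exists q, [/\ List.In q L, forall s, mu_locus N j s -> q s & forall s, q s -> p s].
  suff H i : (i <= n.+1)%N -> exists L : seq (A -> Prop),
      (forall q, List.In q L -> is_prime q /\ exists x, ~ nonbasic N q x) /\
      forall j, (j < i)%N -> forall p, is_prime p -> (forall s, mu_locus N j s -> p s) ->
        exists q, [/\ List.In q L, forall s, mu_locus N j s -> q s & forall s, q s -> p s].
    exact: H (leqnn _).
  elim: i => [|i IHi] lti; first by exists [::].
  have [L [L1 L2]] := IHi (ltnW lti).
  have [L' [L'1 L'2]] := finite_primes_over (mu_locus N i) nA.
  exists (L ++ L'); split=> [q /List.in_app_iff[/L1 //|/L'1[pq hq]]|j].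
    split=> //; have nmu : ~ mu_mod N q i.
      by move=> /(mu_mod_locus pq iN genG)[s qs /hq].
    (* At [q] more than [i] but at most [n.+1] generators are needed. Somewhere between, [mu_mod]
       passes from false to true, and Nakayama's lemma gives a basic element there. *)
    have muq : mu_mod N q (i + (n.+1 - i)).
      by rewrite subnKC 1?ltnW // -[n.+1]subn0; apply: loc => //; apply: dim_quot_ge0.
    elim: (n.+1 - i)%N muq => [|k IHk]; first by rewrite addn0.
    rewrite addnS => muq; case: (EM (mu_mod N q (i + k))) => [/IHk //|].
    exact: exists_basic muq.
  rewrite ltnS leq_eqVlt => /orP[/eqP->|/L2 h] p pp hp.
    have [q [qL' qp]] := L'2 p pp hp; exists q; split=> //.
      by apply/List.in_app_iff; right.
    by case: (L'1 q qL').
  by have [q [qL ? ?]] := h p pp hp; exists q; split=> //; apply/List.in_app_iff; left.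
have [m hm] := common_basic iN L1.
have iN' := add_multiples_submod m all_coefs_ideal iN.
have NN' x : N x -> add_multiples all_coefs m N x.
  by move=> Nx; exists 0; rewrite // scale0r subr0.
have [p pp k dk|ms sms genms] := IHn _ iN'; last first.
  exists (m :: ms) => // x; apply: span_all_min (genms x); first exact: span_submod.
    move=> y [a _ Ny]; exists a => //; exact: sub_span.
  by move=> y yms; apply: mem_span_all; rewrite // inE yms orbT.
case: (EM (mu_mod N p (n - k))) => [|nmu]; first exact: mu_mod_mono.
(* If [k > n], both [n - k] and [n.+1 - k] are 0, so the hypothesis at [p] contradicts [nmu]. *)
have lekn : (k <= n)%N.
  rewrite leqNgt; apply/negP => ltnk; apply: nmu.
  by have := loc p pp k dk; rewrite (eqP ltnk) (eqP (ltnW ltnk)).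
have locus_p s : mu_locus N (n - k) s -> p s.
  by move=> hs; apply: contrapT => ps; apply: nmu; apply: mu_locus_mod hs.
(* If [q = p], then [m] is basic at [p] and dividing by it saves a generator. If [q] is strictly
   smaller, its quotient has dimension at least [k.+1], so [n - k] generators suffice at [q],
   contrary to its choice. *)
have [q [qL hq qp]] := L2 _ (leq_subr k n) p pp locus_p.
have [pq _] := L1 q qL.
case: (EM (forall s, p s -> q s)) => [pq'|npq].
  have {}pq' := prime_antisym pq' qp; apply: mu_mod_basic => //; first by rewrite pq'; apply: hm.
  by rewrite -subSn //; apply: loc.
have : mu_mod N q (n.+1 - k.+1).
  apply: loc => //; apply: dim_quot_ge_cons dk => //; split=> //.
  apply: contrapT => nx; apply: npq => x px; apply: contrapT => qx; apply: nx.
  by exists x.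
by rewrite subSS => /(mu_mod_locus pq iN genG)[s qs /hq].
Qed.

Lemma span0_codom r (m : 'I_r -> M) (a : 'I_r -> A) :
  span all_coefs (fun y => y = 0) (codom m) (\sum_i a i *: m i).
Proof.
have i0 : is_submod (fun y : M => y = 0).
  by split=> [|x y -> ->|b x ->]; rewrite ?addr0 ?scaler0.
have [S0 SD SZ] := span_submod (codom m) all_coefs_ideal i0.
by apply: (big_ind _ S0 SD) => i _; apply/SZ/mem_span_all/codom_f.
Qed.

Theorem forster_swan n : noetherian A -> fin_gen M -> e_le M n -> generated_by M n.
Proof.
move=> nA [r [g gen]] e_n.
have i0 : is_submod (fun y : M => y = 0).
  by split=> [|x y -> ->|b x ->]; rewrite ?addr0 ?scaler0.
have [x|p pp k dk|ms sms genms] := @forster_swan_mod (codom g) _ n nA _ i0.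
- by have [a ->] := gen x; apply: span0_codom.
- have [_ [m hm]] := e_n p pp k dk; exists (codom m); first by rewrite size_codom card_ord.
  by move=> x; have [s [a [ps e]]] := hm x; exists s; rewrite // e; apply: span0_codom.
(* The list may be shorter than [n]; the default value 0 pads it. *)
exists (fun i => ms`_i) => x.
apply: (span_all_min (K := fun y => exists a : 'I_n -> A, y = \sum_i a i *: ms`_i)) (genms x).
- split=> [|_ _ [a ->] [b ->]|c _ [a ->]].
  + by exists (fun=> 0); rewrite big1 // => i _; rewrite scale0r.
  + exists (fun i => a i + b i); rewrite -big_split.
    by apply: eq_bigr => i _; rewrite scalerDl.
  + exists (fun i => c * a i); rewrite scaler_sumr.
    by apply: eq_bigr => i _; rewrite scalerA.
- by move=> y ->; exists (fun=> 0); rewrite big1 // => i _; rewrite scale0r.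
move=> m mms; have ltm : (index m ms < n)%N by apply: leq_trans sms; rewrite index_mem.
exists (fun i => (i == Ordinal ltm)%:R).
rewrite (bigD1 (Ordinal ltm)) //= eqxx scale1r nth_index // big1 ?addr0 // => i /negPf ->.
by rewrite scale0r.
Qed.

End Modules.

(** * Noetherian rings from adjoining finitely many elements *)

Section ReesNoetherian.
Variable T : comNzRingType.

(** The maps have equal images and [phi] is injective, so [A] is a quotient of [S]. Ideals of [A]
    are pulled back to [S] through [T], and their generators are carried back. *)
Lemma noetherian_preimage (S A : comNzRingType) (psi : {rmorphism S -> T})
    (phi : {rmorphism A -> T}) :
  noetherian S -> injective phi ->
  (forall a, exists s, psi s = phi a) -> (forall s, exists a, phi a = psi s) ->
  noetherian A.
Proof.
move=> nS phiI surj back J iJ; case: (iJ) => J0 JD JM.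
pose J' s := exists2 a, J a & phi a = psi s.
have iJ' : is_ideal J'.
  split=> [|s t [a Ja ea] [b Jb eb]|r s [a Ja ea]].
  - by exists 0; rewrite ?rmorph0.
  - by exists (a + b); [apply: JD|rewrite !rmorphD ea eb].
  - by have [c ec] := back r; exists (c * a); [apply: JM|rewrite !rmorphM ea ec].
have [n [g [Jg gJ]]] := nS J' iJ'.
have /choice[h hP] i : exists a, J a /\ phi a = psi (g i).
  by have [a Ja ea] := Jg i; exists a.
exists n, h; split=> [i|a Ja]; first by case: (hP i).
have [s es] := surj a; have [|r er] := gJ s; first by exists a.
have /choice[b eb] i := back (r i).
exists b; apply: phiI; rewrite -es er !rmorph_sum; apply: eq_bigr => i _.
by rewrite !rmorphM eb (hP i).2.
Qed.

Definition is_subring (B : T -> Prop) : Prop :=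
  [/\ B 1, forall x y, B x -> B y -> B (x - y) & forall x y, B x -> B y -> B (x * y)].

Lemma subring_sum B (I : Type) (r : seq I) (F : I -> T) :
  is_subring B -> (forall i, B (F i)) -> B (\sum_(i <- r) F i).
Proof.
move=> [B1 BB _] BF; have B0 : B 0 by rewrite -(subrr 1); apply: BB.
apply: (big_ind B) => // x y Bx By; rewrite -[y]opprK; apply: (BB) => //.
by rewrite -sub0r; apply: BB.
Qed.

Lemma subring_prod B (I : Type) (r : seq I) (F : I -> T) :
  is_subring B -> (forall i, B (F i)) -> B (\prod_(i <- r) F i).
Proof. by move=> [B1 _ BM] BF; apply: (big_ind B). Qed.

Lemma subringX B x n : is_subring B -> B x -> B (x ^+ n).
Proof.
move=> [B1 _ BM] Bx; elim: n => [|n IH]; rewrite ?expr0 ?exprS //; exact: BM.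
Qed.

Lemma rmorph_subring (S : comNzRingType) (psi : {rmorphism S -> T}) :
  is_subring (fun y => exists s, psi s = y).
Proof.
split=> [|_ _ [s <-] [t <-]|_ _ [s <-] [t <-]]; first by exists 1; rewrite rmorph1.
  by exists (s - t); rewrite rmorphB.
by exists (s * t); rewrite rmorphM.
Qed.

(** [S] is a polynomial ring over [R], with one variable for each entry of [xs], and [psi] is
    evaluation. The last clause bounds its image from above. *)
Lemma noetherian_adjoin (R : comNzRingType) (iota : {rmorphism R -> T}) (xs : seq T) :
  noetherian R ->
  exists (S : comNzRingType) (psi : {rmorphism S -> T}),
    [/\ noetherian S, forall r, exists s, psi s = iota r,
        forall x, x \in xs -> exists s, psi s = x &
        forall B, is_subring B -> (forall r, B (iota r)) ->
          (forall x, x \in xs -> B x) -> forall s, B (psi s)].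
Proof.
move=> nR; elim: xs => [|x xs [S [psi [nS psiR psix psimin]]]].
  by exists R, iota; split=> // r; exists r.
have cx : commr_rmorph psi x by move=> s; apply: mulrC.
exists {poly S}, (horner_morph cx : {rmorphism {poly S} -> T}); split.
- exact: hilbert_basis.
- by move=> r; have [s <-] := psiR r; exists s%:P; apply: horner_morphC.
- move=> y; rewrite inE => /orP[/eqP->|/psix[s <-]].
    by exists 'X; apply: horner_morphX.
  by exists s%:P; apply: horner_morphC.
move=> B sB BR Bx p; case: (sB) => _ _ BM.
rewrite [X in B X](_ : _ = (map_poly psi p).[x]) // horner_coef.
apply: subring_sum => // i; apply: BM; last first.
  by apply: subringX => //; apply: Bx; rewrite mem_head.
rewrite coef_map; apply: psimin => // y yxs; apply: Bx.
by rewrite inE yxs orbT.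
Qed.

End ReesNoetherian.

(** * Generators of the Rees algebras *)

Section ReesGenerators.
Variables (R : idomainType) (I : R -> Prop).
Local Notation T := {fraction {poly R}}.
Local Notation tof := (@FracField.tofrac {poly R}).

Lemma ideal_pow0_all r : ideal_pow I 0 r.
Proof.
exists 1%N, (fun=> r), (fun _ _ => 0); split=> [j []//|].
by rewrite big_ord1 big_ord0 mulr1.
Qed.

Lemma ideal_pow_eq0 n : ideal_pow I n 0.
Proof.
by exists 0%N, (fun=> 0), (fun _ _ => 0); rewrite big_ord0; split=> // -[].
Qed.

Lemma ideal_pow1_mem a : I a -> ideal_pow I 1 a.
Proof.
by move=> Ia; exists 1%N, (fun=> 1), (fun _ _ => a); rewrite !big_ord1 mul1r.
Qed.

Lemma rees_set_const r : rees_set I (tof r%:P).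
Proof.
exists r%:P; split=> // -[|i]; rewrite coefC /=; first exact: ideal_pow0_all.
exact: ideal_pow_eq0.
Qed.

Lemma rees_set_gen a : I a -> rees_set I (tof (a%:P * 'X)).
Proof.
move=> Ia; exists (a%:P * 'X); split=> // -[|[|i]]; rewrite coefCM coefX /= ?mulr0 ?mulr1.
- exact: ideal_pow_eq0.
- exact: ideal_pow1_mem.
- exact: ideal_pow_eq0.
Qed.

Lemma ext_rees_set_rees f : rees_set I f -> ext_rees_set I f.
Proof.
move=> [p [-> hp]]; exists 0%N, p; split=> [|i _]; last by rewrite subn0.
by rewrite expr0 rmorph1 divr1.
Qed.

Lemma ext_rees_set_Xinv : ext_rees_set I (tof 'X)^-1.
Proof.
exists 1%N, 1; split=> [|i i1]; first by rewrite rmorph1 div1r.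
by rewrite coefC; case: i i1 => // i _; apply: ideal_pow_eq0.
Qed.

Variable B : T -> Prop.
Hypothesis subringB : is_subring B.
Hypothesis Bconst : forall r, B (tof r%:P).
Hypothesis Bgen : forall a, I a -> B (tof (a%:P * 'X)).

Lemma subring_ideal_pow n c : ideal_pow I n c -> B (tof (c%:P * 'X^n)).
Proof.
move=> [k [r [a [Ia ->]]]]; rewrite rmorph_sum mulr_suml rmorph_sum.
apply: subring_sum => // j; case: (subringB) => _ _ BM.
rewrite /= polyCM -mulrA rmorphM; apply: BM; first exact: Bconst.
(* The power ['X^n] is split into [n] factors, each paired with one factor from [I] to form a
   generator. *)
rewrite rmorph_prod -[X in 'X^X](card_ord n) -prodr_const -big_split /=.
rewrite (rmorph_prod tof).
by apply: subring_prod => // l; apply: Bgen.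
Qed.

Lemma rees_set_min f : rees_set I f -> B f.
Proof.
move=> [p [-> hp]]; rewrite -[p]coefK poly_def rmorph_sum.
by apply: subring_sum => // i; rewrite -mul_polyC; apply: subring_ideal_pow.
Qed.

Lemma ext_rees_set_min f : B (tof 'X)^-1 -> ext_rees_set I f -> B f.
Proof.
move=> BXV [N [p [-> hp]]]; rewrite -[p]coefK poly_def rmorph_sum mulr_suml.
have X0 : tof 'X != 0 by rewrite tofrac_eq0 polyX_eq0.
case: (subringB) => _ _ BM.
apply: subring_sum => // i; rewrite -mul_polyC.
(* For [N <= i] the term is an element of [I^(i - N)] times [t^(i - N)]; otherwise it is a constant
   times a power of [t^-1]. *)
have [leNi|ltiN] := leqP N i.
  rewrite -(subnK leNi) exprD mulrA /= (rmorphM tof) /= mulfK.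
    by apply: subring_ideal_pow; rewrite subnK //; apply: hp.
  by rewrite rmorphXn expf_neq0.
rewrite -(subnK (ltnW ltiN)) exprD /= !(rmorphM tof) /= invfM mulrACA divff ?mulr1.
  by apply: BM => //; rewrite rmorphXn -exprVn; apply: subringX.
by rewrite rmorphXn expf_neq0.
Qed.

End ReesGenerators.

Lemma noetherian_rees (R : idomainType) (I : R -> Prop) (A : comNzRingType)
    (phi : {rmorphism A -> {fraction {poly R}}}) :
  noetherian R -> is_ideal I -> injective phi ->
  ((forall y, rees_set I y <-> exists a, phi a = y) \/
   (forall y, ext_rees_set I y <-> exists a, phi a = y)) ->
  noetherian A.
Proof.
move=> nR iI phiI imA; have sA := rmorph_subring phi.
have reesA y : rees_set I y -> exists a, phi a = y.
  by case: imA => h hy; apply/h => //; apply: ext_rees_set_rees.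
have [n [g [Ig gI]]] := nR I iI.
pose iota := [the {rmorphism R -> {fraction {poly R}}} of
  (@FracField.tofrac {poly R}) \o (@polyC R)].
pose xs := [seq FracField.tofrac ((g i)%:P * 'X) | i <- enum 'I_n].
(* [ys] holds the generators beyond the [g_i t]: none for [R[It]], and [t^-1] for the extended
   algebra. *)
have generated ys :
    (forall y, y \in ys -> exists a, phi a = y) ->
    (forall B, is_subring B -> (forall r, B (iota r)) ->
       (forall y, y \in xs ++ ys -> B y) -> forall a, B (phi a)) ->
    noetherian A.
  move=> ysA min; have [S [psi [nS psiR psix psimin]]] := noetherian_adjoin iota (xs ++ ys) nR.
  apply: (noetherian_preimage nS phiI) => [a|s].
    exact: (min _ (rmorph_subring psi)).
  apply: (psimin _ sA) => [r|x]; first exact/reesA/rees_set_const.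
  rewrite mem_cat => /orP[/mapP[i _ ->]|/ysA //].
  exact/reesA/rees_set_gen.
have Bgen B ys : is_subring B -> (forall r, B (iota r)) ->
    (forall y, y \in xs ++ ys -> B y) ->
    forall a, I a -> B (FracField.tofrac (a%:P * 'X)).
  move=> sB BR Bx a /gI[r ->]; rewrite rmorph_sum mulr_suml rmorph_sum.
  apply: subring_sum => // i; case: (sB) => _ _ BM.
  rewrite /= polyCM -mulrA rmorphM; apply: BM; first exact: BR.
  by apply: Bx; rewrite mem_cat; apply/orP; left; apply/mapP; exists i; rewrite ?mem_enum.
case: imA => imA.
  apply: (generated [::]) => // B sB BR Bx a.
  by apply: (rees_set_min sB BR (Bgen B _ sB BR Bx)); apply/imA; exists a.
apply: (generated [:: (FracField.tofrac 'X)^-1]) => [y|B sB BR Bx a].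
  by rewrite inE => /eqP->; apply/imA; apply: ext_rees_set_Xinv.
apply: (ext_rees_set_min sB BR (Bgen B _ sB BR Bx)).
  by apply: Bx; rewrite mem_cat mem_head orbT.
by apply/imA; exists a.
Qed.

(** An abstract [A] embedded in the fraction field of [R[t]] with prescribed image covers both
    algebras, and [e_le M n] expresses [e(M) <= n] without forming the supremum. *)
Theorem theorem4p1 (R : idomainType) (d : nat) (I : R -> Prop)
  (A : comNzRingType) (phi : {rmorphism A -> {fraction {poly R}}})
  (M : lmodType A) :
  noetherian R -> krull_dim_eq R d -> is_ideal I ->
  injective phi ->
  ((forall y, rees_set I y <-> exists a, phi a = y) \/
   (forall y, ext_rees_set I y <-> exists a, phi a = y)) ->
  fin_gen M -> (exists x : M, x <> 0) ->
  forall n : nat, e_le M n -> generated_by M n.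
Proof.
by move=> nR _ iI phiI imA fgM _ n; apply: forster_swan (noetherian_rees nR iI phiI imA) fgM.
Qed.
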